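(* $$\frac{165\pi}{4\sqrt{3}} = \sum_{k=0}^{\infty}\left(\frac14\right)^{k}\frac{\left(\frac56\right)_k\left(\frac53\right)_k}{\left(\frac{17}{12}\right)_k\left(\frac{23}{12}\right)_k}\cdot\frac{108k^2+174k+71}{(k+1)(6k+1)}.$$
   Context: For $k\in\mathbb{N}_0$, $(\alpha)_k=\alpha(\alpha+1)\cdots(\alpha+k-1)$ is the rising factorial (Pochhammer symbol), with $(\alpha)_0=1$. *)

(* Defs.v *)
(* Stdlib real numbers, with Coquelicot for series. *)
From Stdlib Require Import Reals.
From Coquelicot Require Import Coquelicot.

Open Scope R_scope.

Fixpoint pochhammer (a : R) (k : nat) : R :=
  match k with
  | O => 1
  | S j => pochhammer a j * (a + INR j)
  end.

(* Main.v *)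
(** Two WZ pairs share the intermediate sum
    [Omega = sum_k (1/3)_k / ((k+1) (7/6)_k)].  The pair [accel_F], [accel_G] comes
    from raising both lower parameters of
    [sum_k (1)_k (1/3)_k / ((c)_k (d)_k)] by one, starting at [(c, d) = (2, 7/6)];
    it turns [Omega] into the series of the theorem divided by 55.  The pair
    [psi_F], [psi_G] raises only the parameter 7/6 and turns [6 Omega] into
    [sum_n 1 / ((n + 1/6) (n + 5/6))], which is [9 PI / (2 sqrt 3)] by
    integrating [(1 + x^2) / (1 + x^2 + x^4) = (1 - x^4) / (1 - x^6)]
    over [[0, 1]]. *)
Require Import Defs.
From Stdlib Require Import Reals Lra Lia.
From Coquelicot Require Import Coquelicot.
Open Scope R_scope.

(** * Telescoping series and WZ pairs *)

Lemma is_series_telescope (u : nat -> R) (l : R) :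
  is_lim_seq u l -> is_series (fun k => u (S k) - u k) (l - u O).
Proof.
  intros Hu.
  assert (H : is_lim_seq (fun n => u (S n) - u O) (l - u O)).
  { apply is_lim_seq_minus'.
    - now apply is_lim_seq_incr_1 in Hu.
    - apply is_lim_seq_const. }
  apply (is_lim_seq_ext (fun n => u (S n) - u O) _ (l - u O)); [ | exact H ].
  intros n; induction n as [|n IH].
  - now rewrite sum_O.
  - rewrite sum_Sn, <- IH; unfold plus; simpl; ring.
Qed.

(** Summed over [k], the right side of the WZ equation telescopes to [- G n O], because [G n]
    vanishes at infinity. So [G n O] is the drop from [Series (F n)] to [Series (F (S n))]. These
    drops telescope in turn, and nothing is left at infinity since [Series (F n)] is at most
    [c n * Series b] in absolute value. *)
Lemma wz_series (F G : nat -> nat -> R) (b c : nat -> R) :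
  (forall n k, F (S n) k - F n k = G n (S k) - G n k) ->
  (forall n, is_lim_seq (G n) 0) ->
  (forall n k, Rabs (F n k) <= c n * b k) ->
  ex_series b -> is_lim_seq c 0 ->
  is_series (fun n => G n O) (Series (F O)).
Proof.
  intros Hwz HG Hdom Hb Hc.
  assert (Hcb : forall n, ex_series (fun k => c n * b k)).
  { intros n; apply (ex_series_scal_l (c n) b Hb). }
  assert (Habs : forall n, ex_series (fun k => Rabs (F n k))).
  { intros n; apply (ex_series_le (fun k => Rabs (F n k)) (fun k => c n * b k)); auto.
    intros k; unfold norm; simpl; unfold abs; simpl.
    rewrite Rabs_Rabsolu; apply Hdom. }
  assert (HF : forall n, ex_series (F n)).
  { intros n; now apply ex_series_Rabs. }
  assert (Hstep : forall n, Series (F (S n)) - Series (F n) = - G n O).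
  { intros n; rewrite <- Series_minus by auto.
    rewrite (Series_ext _ (fun k => G n (S k) - G n k)) by auto.
    apply is_series_unique.
    replace (- G n O) with (0 - G n O) by ring.
    now apply is_series_telescope. }
  assert (H0 : is_lim_seq (fun n => Series (F n)) 0).
  { apply is_lim_seq_abs_0.
    apply is_lim_seq_le_le with (u := fun _ => 0) (w := fun n => c n * Series b).
    - intros n; split; [apply Rabs_pos|].
      eapply Rle_trans; [now apply Series_Rabs|].
      rewrite <- Series_scal_l.
      apply Series_le; auto.
      intros k; split; [apply Rabs_pos | apply Hdom].
    - apply is_lim_seq_const.
    - replace (Finite 0) with (Rbar_mult 0 (Series b))
        by (simpl; f_equal; ring).
      now apply is_lim_seq_scal_r. }
  apply (is_series_ext (fun n => - Series (F (S n)) - - Series (F n))).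
  { intros n; specialize (Hstep n); lra. }
  replace (Series (F O)) with (- 0 - - Series (F O)) by ring.
  apply (is_series_telescope (fun n => - Series (F n))).
  now apply (is_lim_seq_opp _ 0).
Qed.

(** * Pochhammer symbols *)

Lemma pochhammer_pos (a : R) (k : nat) : 0 < a -> 0 < pochhammer a k.
Proof.
  intros Ha; induction k as [|k IH]; simpl; [lra|].
  apply Rmult_lt_0_compat; auto.
  pose proof (pos_INR k); lra.
Qed.

(** Both sides are the product [a (a+1) ... (a+k)], split off at either end. *)
Lemma pochhammer_shift (a : R) (k : nat) :
  a * pochhammer (a + 1) k = pochhammer a k * (a + INR k).
Proof.
  induction k as [|k IH]; [simpl; ring|].
  rewrite S_INR; cbn [pochhammer].
  rewrite <- Rmult_assoc, IH; ring.
Qed.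

Lemma pochhammer_S_shift (a : R) (k : nat) :
  pochhammer a (S k) = a * pochhammer (a + 1) k.
Proof. now rewrite pochhammer_shift. Qed.

Lemma pochhammer_le (a b : R) (k : nat) :
  0 < a <= b -> pochhammer a k <= pochhammer b k.
Proof.
  intros Hab; induction k as [|k IH]; simpl; [lra|].
  pose proof (pos_INR k).
  apply Rmult_le_compat; try lra.
  apply Rlt_le, pochhammer_pos; lra.
Qed.

Lemma pochhammer_1_2 (k : nat) : pochhammer 2 k = (INR k + 1) * pochhammer 1 k.
Proof.
  generalize (pochhammer_shift 1 k); replace (1 + 1) with 2 by ring; lra.
Qed.

(** * The intermediate sum *)

Definition third_ratio (k : nat) : R := pochhammer (1 / 3) k / pochhammer (7 / 6) k.

Lemma third_ratio_pos (k : nat) : 0 < third_ratio k.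
Proof. apply Rdiv_lt_0_compat; apply pochhammer_pos; lra. Qed.

Lemma third_ratio_S (k : nat) :
  third_ratio (S k) = third_ratio k * ((1 / 3 + INR k) / (7 / 6 + INR k)).
Proof.
  unfold third_ratio; cbn [pochhammer].
  pose proof (pos_INR k); pose proof (pochhammer_pos (7 / 6) k).
  field; repeat split; lra.
Qed.

(** The ratio decays like [k^(-5/6)], faster than [k^(-1/2)]; squaring turns the induction step into
    a comparison of rational functions. *)
Lemma third_ratio_sqr_le (k : nat) : third_ratio k ^ 2 <= / (INR k + 1).
Proof.
  induction k as [|k IH]; [unfold third_ratio; simpl; lra|].
  rewrite third_ratio_S, S_INR; pose proof (pos_INR k) as Hk.
  rewrite Rpow_mult_distr.
  apply Rle_trans with
    (/ (INR k + 1) * ((1 / 3 + INR k) / (7 / 6 + INR k)) ^ 2).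
  { apply Rmult_le_compat_r; [apply pow2_ge_0 | exact IH]. }
  set (x := INR k) in *.
  apply Rminus_le.
  replace (_ - _) with
    (- ((2 / 3) * x ^ 2 + (9 / 4) * x + 41 / 36)
       / ((x + 1) * (x + 1 + 1) * (7 / 6 + x) ^ 2)).
  - unfold Rdiv; rewrite Ropp_mult_distr_l_reverse.
    apply Rge_le, Ropp_0_le_ge_contravar, Rlt_le, Rdiv_lt_0_compat; nra.
  - field; repeat split; lra.
Qed.

Lemma is_lim_seq_inv_INR_1 : is_lim_seq (fun n => / (INR n + 1)) 0.
Proof.
  apply (is_lim_seq_ext (fun n => / INR (S n))).
  { intros n; now rewrite S_INR. }
  apply (is_lim_seq_incr_1 (fun n => / INR n)).
  apply (is_lim_seq_inv _ p_infty); [apply is_lim_seq_INR | discriminate].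
Qed.

Lemma is_lim_third_ratio : is_lim_seq third_ratio 0.
Proof.
  apply (is_lim_seq_ext (fun k => sqrt (third_ratio k ^ 2))).
  { intros k; apply sqrt_pow2, Rlt_le, third_ratio_pos. }
  rewrite <- sqrt_0.
  apply is_lim_seq_continuous; [apply continuity_pt_sqrt; lra|].
  apply is_lim_seq_le_le with (u := fun _ => 0) (w := fun k => / (INR k + 1)).
  - intros k; split; [apply pow2_ge_0 | apply third_ratio_sqr_le].
  - apply is_lim_seq_const.
  - apply is_lim_seq_inv_INR_1.
Qed.

Definition omega_term (k : nat) : R := third_ratio k / (INR k + 1).

Lemma ex_series_omega : ex_series omega_term.
Proof.
  (* [third_ratio k - third_ratio (S k) = (5/6) third_ratio k / (k + 7/6)] telescopes. *)
  apply (ex_series_le (K := R_AbsRing) (V := R_CompleteNormedModule) omega_term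
           (fun k => - (7 / 5) * (third_ratio (S k) - third_ratio k))).
  - intros k; unfold norm; simpl; unfold abs; simpl; unfold omega_term.
    pose proof (pos_INR k); pose proof (third_ratio_pos k).
    rewrite Rabs_pos_eq by (apply Rlt_le, Rdiv_lt_0_compat; lra).
    rewrite third_ratio_S.
    apply Rminus_le.
    (* The constant 7/5 is 6/5 times 7/6, the largest value of [(k + 7/6) / (k + 1)]. It is attained
       at [k = 0], hence the factor [k] here. *)
    replace (_ - _) with
      (- (third_ratio k * (INR k / 6) / ((INR k + 1) * (7 / 6 + INR k))))
      by (field; lra).
    apply Rge_le, Ropp_0_le_ge_contravar.
    apply Rmult_le_pos; [nra | apply Rlt_le, Rinv_0_lt_compat; nra].
  - apply (ex_series_scal_l (- (7 / 5)) (fun k => third_ratio (S k) - third_ratio k)).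
    eexists; apply is_series_telescope, is_lim_third_ratio.
Qed.

(** * Raising one parameter *)

(** The index [S k] contributes an extra factor [1/6 + n] to the denominator. It makes the sums over
    [k] tend to 0 as [n] grows, and at [n = 0] it produces the 6 in [6 Omega]. *)
Definition psi_F (n k : nat) : R :=
  pochhammer (1 / 3) k / ((INR k + 1) * pochhammer (1 / 6 + INR n) (S k)).

Definition psi_G (n k : nat) : R :=
  pochhammer (1 / 3) k / (pochhammer (1 / 6 + INR n) (S k) * (5 / 6 + INR n)).

Lemma psi_wz (n k : nat) :
  psi_F (S n) k - psi_F n k = psi_G n (S k) - psi_G n k.
Proof.
  unfold psi_F, psi_G.
  rewrite !S_INR.
  (* Every denominator is brought to a multiple of [pochhammer (1 / 6 + INR n + 1) k], which leaves
     a rational identity in [n] and [k]. *)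
  replace (1 / 6 + (INR n + 1)) with (1 / 6 + INR n + 1) by ring.
  rewrite !(pochhammer_S_shift (1 / 6 + INR n)).
  cbn [pochhammer].
  pose proof (pos_INR n); pose proof (pos_INR k).
  pose proof (pochhammer_pos (1 / 6 + INR n + 1) k).
  field; repeat split; lra.
Qed.

(** Confines the dependence on [n] to a front factor, as the domination by [c n * b k] in
    [wz_series] requires. *)
Lemma psi_denominator_ge (n k : nat) :
  (1 / 6 + INR n) * pochhammer (7 / 6) k <= pochhammer (1 / 6 + INR n) (S k).
Proof.
  rewrite pochhammer_S_shift; pose proof (pos_INR n).
  apply Rmult_le_compat_l; [lra|].
  apply pochhammer_le; lra.
Qed.

Lemma psi_F_bound (n k : nat) :
  Rabs (psi_F n k) <= / (1 / 6 + INR n) * omega_term k.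
Proof.
  unfold psi_F, omega_term, third_ratio.
  pose proof (pos_INR n); pose proof (pos_INR k).
  pose proof (pochhammer_pos (1 / 6 + INR n) (S k)).
  pose proof (pochhammer_pos (1 / 3) k); pose proof (pochhammer_pos (7 / 6) k).
  rewrite Rabs_pos_eq
    by (apply Rlt_le, Rdiv_lt_0_compat; [|apply Rmult_lt_0_compat]; lra).
  replace (/ (1 / 6 + INR n) * _) with
    (pochhammer (1 / 3) k
       / ((INR k + 1) * ((1 / 6 + INR n) * pochhammer (7 / 6) k)))
    by (field; repeat split; lra).
  apply Rmult_le_compat_l; [lra|].
  apply Rinv_le_contravar.
  - repeat apply Rmult_lt_0_compat; lra.
  - apply Rmult_le_compat_l; [lra | apply psi_denominator_ge].
Qed.

Lemma is_lim_psi_G (n : nat) : is_lim_seq (psi_G n) 0.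
Proof.
  pose proof (pos_INR n).
  apply is_lim_seq_le_le with (u := fun _ => 0)
    (w := fun k => / ((1 / 6 + INR n) * (5 / 6 + INR n)) * third_ratio k).
  - intros k; unfold psi_G, third_ratio.
    pose proof (pochhammer_pos (1 / 6 + INR n) (S k)).
    pose proof (pochhammer_pos (1 / 3) k); pose proof (pochhammer_pos (7 / 6) k).
    split.
    { apply Rlt_le, Rdiv_lt_0_compat; [|apply Rmult_lt_0_compat]; lra. }
    replace (/ _ * _) with
      (pochhammer (1 / 3) k
         / ((1 / 6 + INR n) * pochhammer (7 / 6) k * (5 / 6 + INR n)))
      by (field; repeat split; lra).
    apply Rmult_le_compat_l; [lra|].
    apply Rinv_le_contravar.
    + repeat apply Rmult_lt_0_compat; lra.
    + apply Rmult_le_compat_r; [lra | apply psi_denominator_ge].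
  - apply is_lim_seq_const.
  - replace (Finite 0)
      with (Rbar_mult (/ ((1 / 6 + INR n) * (5 / 6 + INR n))) 0)
      by (simpl; f_equal; ring).
    apply is_lim_seq_scal_l, is_lim_third_ratio.
Qed.

Lemma is_lim_seq_inv_INR_sixth : is_lim_seq (fun n => / (1 / 6 + INR n)) 0.
Proof.
  apply (is_lim_seq_inv _ p_infty); [|discriminate].
  apply (is_lim_seq_plus (fun _ => 1 / 6) INR (1 / 6) p_infty p_infty);
    [apply is_lim_seq_const | apply is_lim_seq_INR | reflexivity].
Qed.

Lemma is_series_psi :
  is_series (fun n => / ((1 / 6 + INR n) * (5 / 6 + INR n))) (6 * Series omega_term).
Proof.
  rewrite <- Series_scal_l, (Series_ext _ (psi_F O)).
  - apply (is_series_ext (fun n => psi_G n O)).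
    { intros n; unfold psi_G; simpl; pose proof (pos_INR n); field; lra. }
    eapply wz_series;
      [ exact psi_wz | exact is_lim_psi_G | exact psi_F_bound
      | exact ex_series_omega | exact is_lim_seq_inv_INR_sixth ].
  - intros k; unfold psi_F, omega_term, third_ratio.
    rewrite pochhammer_S_shift; simpl INR.
    replace (1 / 6 + 0 + 1) with (7 / 6) by field.
    pose proof (pos_INR k); pose proof (pochhammer_pos (7 / 6) k).
    field; lra.
Qed.

(** * Evaluation of the sum by an arctangent integral *)

(** Comes from [1 + x^2 + x^4 = (1 + x + x^2) (1 - x + x^2)]: the integrand is half the sum of the
    reciprocals of the two factors, and [4 (1 + x + x^2) = (2x + 1)^2 + 3], likewise with [-x]. *)
Definition atan_primitive (x : R) : R :=
  (atan ((2 * x + 1) / sqrt 3) + atan ((2 * x - 1) / sqrt 3)) / sqrt 3.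

Lemma is_derive_atan_primitive (x : R) :
  is_derive atan_primitive x ((1 + x ^ 2) / (1 + x ^ 2 + x ^ 4)).
Proof.
  assert (Hs : 0 < sqrt 3) by (apply sqrt_lt_R0; lra).
  assert (Hs2 : sqrt 3 ^ 2 = 3) by (apply pow2_sqrt; lra).
  assert (H1 : 0 < 1 + x ^ 2 + x ^ 4) by nra.
  assert (Hq : forall t, 1 + (t / sqrt 3) ^ 2 = (3 + t ^ 2) / 3).
  { intros t; unfold Rdiv; rewrite Rpow_mult_distr, pow_inv, Hs2; field. }
  unfold atan_primitive; auto_derive; [lra|].
  replace (1 + (2 * x + 1) * / sqrt 3 * _) with ((3 + (2 * x + 1) ^ 2) / 3)
    by (rewrite <- Hq; unfold Rdiv; ring).
  replace (1 + (2 * x + - (1)) * / sqrt 3 * _) with ((3 + (2 * x - 1) ^ 2) / 3)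
    by (rewrite <- Hq; unfold Rdiv; ring).
  transitivity (6 * (/ (3 + (2 * x + 1) ^ 2) + / (3 + (2 * x - 1) ^ 2)) / sqrt 3 ^ 2).
  { field; repeat split; nra. }
  rewrite Hs2; field; repeat split; nra.
Qed.

Lemma atan_primitive_0 : atan_primitive 0 = 0.
Proof.
  unfold atan_primitive.
  replace ((2 * 0 - 1) / sqrt 3) with (- ((2 * 0 + 1) / sqrt 3))
    by (unfold Rdiv; ring).
  rewrite atan_opp; unfold Rdiv; ring.
Qed.

Lemma atan_primitive_1 : atan_primitive 1 = PI / (2 * sqrt 3).
Proof.
  assert (Hs : 0 < sqrt 3) by (apply sqrt_lt_R0; lra).
  assert (Hs2 : sqrt 3 * sqrt 3 = 3) by (apply sqrt_sqrt; lra).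
  unfold atan_primitive.
  replace ((2 * 1 + 1) / sqrt 3) with (tan (PI / 3)).
  2:{ rewrite tan_PI3; field_simplify_eq; lra. }
  replace ((2 * 1 - 1) / sqrt 3) with (tan (PI / 6)).
  2:{ rewrite tan_PI6; field; lra. }
  pose proof PI_RGT_0.
  rewrite !atan_tan by lra.
  field; lra.
Qed.

(** The integral of [t^(6k) (1 - t^4)] from 0 to [x]. *)
Definition mod6_term (x : R) (k : nat) : R :=
  x ^ (6 * k + 1) / (6 * INR k + 1) - x ^ (6 * k + 5) / (6 * INR k + 5).

Lemma is_derive_mod6_term (x : R) (k : nat) :
  is_derive (fun y => mod6_term y k) x (x ^ (6 * k) * (1 - x ^ 4)).
Proof.
  pose proof (pos_INR k).
  unfold mod6_term; auto_derive; [repeat split; lra|].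
  change (k + _)%nat with (6 * k)%nat.
  replace (pred (6 * k + 1)) with (6 * k)%nat by lia.
  replace (pred (6 * k + 5)) with (6 * k + 4)%nat by lia.
  rewrite !plus_INR, !mult_INR, pow_add.
  replace (INR 6) with 6 by (simpl; ring); replace (INR 5) with 5 by (simpl; ring).
  set (y := x ^ (6 * k)); simpl INR; field; lra.
Qed.

(** A finite geometric sum of ratio [x^6]. Cancelling [1 - x^2] from [(1 - x^4) / (1 - x^6)] keeps
    the formula valid at [x = 1]. *)
Lemma is_derive_sum_mod6 (x : R) (N : nat) :
  is_derive (fun y => sum_n (mod6_term y) N) x
    ((1 + x ^ 2) / (1 + x ^ 2 + x ^ 4) * (1 - x ^ (6 * S N))).
Proof.
  assert (H1 : 0 < 1 + x ^ 2 + x ^ 4) by nra.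
  induction N as [|N IH].
  - apply (is_derive_ext (fun y => mod6_term y O)).
    { intros y; now rewrite sum_O. }
    evar_last; [apply is_derive_mod6_term|].
    simpl pow; field; simpl pow in H1; lra.
  - apply (is_derive_ext (fun y => sum_n (mod6_term y) N + mod6_term y (S N))).
    { intros y; now rewrite sum_Sn. }
    evar_last.
    { apply (is_derive_plus (V := R_NormedModule));
        [exact IH | apply is_derive_mod6_term]. }
    unfold plus; simpl AbelianMonoid.sort.
    replace (6 * S (S N))%nat with (6 * S N + 6)%nat by lia.
    rewrite pow_add.
    set (y := x ^ (6 * S N)).
    cbn -[pow]; field; lra.
Qed.

Lemma derive_nonneg_le (f df : R -> R) (a b : R) :
  a <= b -> (forall x, is_derive f x (df x)) ->
  (forall x, a <= x <= b -> 0 <= df x) -> f a <= f b.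
Proof.
  intros Hab Hf Hpos.
  destruct (MVT_gen f a b df) as [c [Hc Heq]].
  - intros x _; apply Hf.
  - intros x _; apply continuity_pt_filterlim, (ex_derive_continuous f).
    eexists; apply Hf.
  - rewrite Rmin_left, Rmax_right in Hc by lra.
    specialize (Hpos c Hc); nra.
Qed.

(** With [M = 6 (N + 1)], the error is the integral over [[0, 1]] of [x^M] times a factor between 0
    and 1, so it lies between 0 and [1 / (M + 1)]. Instead of integrals, the proof uses that [h]
    (the error as a function of [x]) and [e] (the primitive of [x^M] minus [h]) vanish at 0 and have
    nonnegative derivatives. *)
Lemma sum_mod6_bounds (N : nat) :
  PI / (2 * sqrt 3) - / (INR N + 1) <= sum_n (mod6_term 1) N <= PI / (2 * sqrt 3).
Proof.
  assert (H0 : sum_n (mod6_term 0) N = 0).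
  { induction N as [|N IH]; [rewrite sum_O | rewrite sum_Sn, IH];
      unfold mod6_term, plus; simpl; rewrite ?Nat.add_succ_r; simpl;
      unfold Rdiv; ring. }
  pose (M := (6 * S N)%nat).
  pose (h := fun x => atan_primitive x - sum_n (mod6_term x) N).
  pose (dh := fun x => (1 + x ^ 2) / (1 + x ^ 2 + x ^ 4) * x ^ M).
  assert (Hh : forall x, is_derive h x (dh x)).
  { intros x; unfold h; evar_last.
    { apply (is_derive_minus (V := R_NormedModule));
        [apply is_derive_atan_primitive | apply is_derive_sum_mod6]. }
    unfold dh, M; cbn -[pow Nat.mul]; unfold minus, plus, opp; cbn -[pow Nat.mul]; ring. }
  pose (e := fun x => x ^ S M / INR (S M) - h x).
  assert (He : forall x, is_derive e x (x ^ M - dh x)).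
  { intros x; unfold e; evar_last.
    { apply (is_derive_minus (V := R_NormedModule)); [|apply Hh].
      instantiate (1 := x ^ M).
      pose proof (lt_0_INR (S M) ltac:(lia)).
      auto_derive; [lra|].
      change (1 * (INR (S M) * x ^ M) * / INR (S M) = x ^ M); field; lra. }
    unfold minus, plus, opp; cbn -[pow Nat.mul]; ring. }
  assert (h0 : h 0 = 0) by (unfold h; rewrite atan_primitive_0, H0; ring).
  assert (h1 : h 1 = PI / (2 * sqrt 3) - sum_n (mod6_term 1) N)
    by (unfold h; now rewrite atan_primitive_1).
  assert (e0 : e 0 = 0) by (unfold e; rewrite h0, pow_i by lia; unfold Rdiv; ring).
  assert (e1 : e 1 = / INR (S M) - h 1) by (unfold e; rewrite pow1; unfold Rdiv; ring).
  assert (Hle : / INR (S M) <= / (INR N + 1)).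
  { rewrite <- S_INR; apply Rinv_le_contravar; [apply lt_0_INR; lia|].
    apply le_INR; unfold M; lia. }
  assert (Hq : forall x, 0 <= (1 + x ^ 2) / (1 + x ^ 2 + x ^ 4) <= 1).
  { intros x; assert (0 < 1 + x ^ 2 + x ^ 4) by nra; split.
    - apply Rlt_le, Rdiv_lt_0_compat; nra.
    - apply Rle_div_l; nra. }
  assert (A : h 0 <= h 1).
  { apply derive_nonneg_le with dh; auto; [lra|].
    intros x Hx; apply Rmult_le_pos; [apply Hq | apply pow_le; lra]. }
  assert (B : e 0 <= e 1).
  { apply derive_nonneg_le with (fun x => x ^ M - dh x); auto; [lra|].
    intros x Hx; unfold dh; specialize (Hq x).
    assert (0 <= x ^ M) by (apply pow_le; lra); nra. }
  lra.
Qed.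

Lemma is_series_mod6 : is_series (mod6_term 1) (PI / (2 * sqrt 3)).
Proof.
  apply (is_lim_seq_le_le
    (fun N => PI / (2 * sqrt 3) - / (INR N + 1)) _
    (fun _ => PI / (2 * sqrt 3)) (PI / (2 * sqrt 3))).
  - apply sum_mod6_bounds.
  - evar_last.
    { apply is_lim_seq_minus'; [apply is_lim_seq_const | apply is_lim_seq_inv_INR_1]. }
    simpl; f_equal; ring.
  - apply is_lim_seq_const.
Qed.

Lemma Series_omega : Series omega_term = 3 * PI / (4 * sqrt 3).
Proof.
  assert (H : is_series (fun n => / ((1 / 6 + INR n) * (5 / 6 + INR n)))
                (9 * (PI / (2 * sqrt 3)))).
  (* Partial fractions: [1/(6n+1) - 1/(6n+5) = 4 / ((6n+1) (6n+5))], and 36/4 = 9. *)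
  { apply (is_series_ext (fun n => 9 * mod6_term 1 n)).
    - intros n; unfold mod6_term; rewrite !pow1; match goal with |- ?a = ?b => change (a = b :> R) end.
      pose proof (pos_INR n); field; lra.
    - apply (is_series_scal_l (K := R_AbsRing) 9 _ (PI / (2 * sqrt 3))), is_series_mod6. }
  apply is_series_unique in H.
  rewrite (is_series_unique _ _ is_series_psi) in H.
  assert (0 < sqrt 3) by (apply sqrt_lt_R0; lra).
  replace (3 * PI / (4 * sqrt 3)) with (9 * (PI / (2 * sqrt 3)) / 6) by (field; lra).
  lra.
Qed.

(** * Raising both lower parameters *)

(** By the duplication formula this is [(5/6)_n (5/3)_n / (17/6)_{2n}]. *)
Definition accel_base (n : nat) : R :=
  (1 / 4) ^ n
  * ((pochhammer (5 / 6) n * pochhammer (5 / 3) n)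
     / (pochhammer (17 / 12) n * pochhammer (23 / 12) n)).

(** Equals [(5/6)_n (5/3)_n / ((5/6)_{2n} (n+1) (6n+1))]; the 55 makes it 1 at [n = 0]. *)
Definition accel_coef (n : nat) : R :=
  accel_base n
  * ((12 * INR n + 5) * (12 * INR n + 11) / (55 * ((INR n + 1) * (6 * INR n + 1)))).

Definition accel_F (n k : nat) : R :=
  accel_coef n
  * (pochhammer 1 k * pochhammer (1 / 3) k
     / (pochhammer (2 + INR n) k * pochhammer (7 / 6 + INR n) k)).

(* The linear factor in [k] is the solution of Gosper's equation for [accel_F]. *)
Definition accel_G (n k : nat) : R :=
  accel_F n k
  * ((108 * INR n ^ 2 + 174 * INR n + 71) / ((12 * INR n + 5) * (12 * INR n + 11))
     + 6 * INR k / (12 * INR n + 5)).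

Lemma accel_base_S (n : nat) :
  accel_base (S n) =
  accel_base n * ((5 / 6 + INR n) * (5 / 3 + INR n)
                  / (4 * ((17 / 12 + INR n) * (23 / 12 + INR n)))).
Proof.
  unfold accel_base; cbn [pochhammer pow].
  pose proof (pos_INR n).
  pose proof (pochhammer_pos (17 / 12) n); pose proof (pochhammer_pos (23 / 12) n).
  field; repeat split; lra.
Qed.

Lemma accel_base_bounds (n : nat) : 0 <= accel_base n <= (1 / 4) ^ n.
Proof.
  induction n as [|n IH]; [unfold accel_base; simpl; lra|].
  rewrite accel_base_S; cbn [pow]; pose proof (pos_INR n).
  set (q := _ / _).
  (* Factor by factor, 5/6 is below 17/12 and 5/3 is below 23/12. *)
  assert (Hq : 0 <= q <= 1 / 4).
  { unfold q; split; [apply Rlt_le, Rdiv_lt_0_compat | apply Rle_div_l]; nra. }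
  split; [apply Rmult_le_pos; lra|].
  rewrite (Rmult_comm (1 / 4)); apply Rmult_le_compat; lra.
Qed.

Lemma accel_coef_bounds (n : nat) : 0 <= accel_coef n <= (1 / 4) ^ n.
Proof.
  unfold accel_coef; pose proof (accel_base_bounds n); pose proof (pos_INR n).
  set (q := _ / _).
  (* Expanded: [144 n^2 + 192 n + 55 <= 330 n^2 + 385 n + 55], an equality at [n = 0]. *)
  assert (Hq : 0 <= q <= 1).
  { unfold q; split; [apply Rlt_le, Rdiv_lt_0_compat | apply Rle_div_l]; nra. }
  split; [apply Rmult_le_pos; lra|].
  replace ((1 / 4) ^ n) with ((1 / 4) ^ n * 1) by ring.
  apply Rmult_le_compat; lra.
Qed.

Lemma accel_wz (n k : nat) :
  accel_F (S n) k - accel_F n k = accel_G n (S k) - accel_G n k.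
Proof.
  pose proof (pos_INR n); pose proof (pos_INR k).
  pose proof (pochhammer_pos (2 + INR n) k); pose proof (pochhammer_pos (7 / 6 + INR n) k).
  unfold accel_G, accel_F, accel_coef.
  rewrite accel_base_S, !S_INR; cbn [pochhammer].
  (* Undoing the shift of both lower parameters gives all four terms a common hypergeometric factor;
     what remains is a rational identity. *)
  replace (pochhammer (2 + (INR n + 1)) k)
    with (pochhammer (2 + INR n) k * (2 + INR n + INR k) / (2 + INR n)).
  2:{ rewrite <- pochhammer_shift, Rplus_assoc; field; lra. }
  replace (pochhammer (7 / 6 + (INR n + 1)) k)
    with (pochhammer (7 / 6 + INR n) k * (7 / 6 + INR n + INR k) / (7 / 6 + INR n)).
  2:{ rewrite <- pochhammer_shift, Rplus_assoc; field; lra. }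
  field; repeat split; lra.
Qed.

(** The quotient is largest at [n = 0], where [(2)_k = (k+1) (1)_k] reduces it to [omega_term k]. *)
Lemma accel_quotient_bounds (n k : nat) :
  0 <= pochhammer 1 k * pochhammer (1 / 3) k
       / (pochhammer (2 + INR n) k * pochhammer (7 / 6 + INR n) k)
    <= omega_term k.
Proof.
  unfold omega_term, third_ratio.
  pose proof (pos_INR n); pose proof (pos_INR k).
  pose proof (pochhammer_pos 1 k); pose proof (pochhammer_pos (1 / 3) k).
  pose proof (pochhammer_pos 2 k); pose proof (pochhammer_pos (7 / 6) k).
  pose proof (pochhammer_pos (2 + INR n) k); pose proof (pochhammer_pos (7 / 6 + INR n) k).
  split.
  { apply Rlt_le, Rdiv_lt_0_compat; apply Rmult_lt_0_compat; lra. }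
  replace (pochhammer (1 / 3) k / pochhammer (7 / 6) k / (INR k + 1))
    with (pochhammer 1 k * pochhammer (1 / 3) k
          / (pochhammer 2 k * pochhammer (7 / 6) k))
    by (rewrite pochhammer_1_2; field; repeat split; lra).
  apply Rmult_le_compat_l; [apply Rmult_le_pos; lra|].
  apply Rinv_le_contravar; [apply Rmult_lt_0_compat; lra|].
  apply Rmult_le_compat; try lra; apply pochhammer_le; lra.
Qed.

Lemma accel_F_bounds (n k : nat) : 0 <= accel_F n k <= (1 / 4) ^ n * omega_term k.
Proof.
  pose proof (accel_quotient_bounds n k); pose proof (accel_coef_bounds n).
  unfold accel_F; split; [apply Rmult_le_pos | apply Rmult_le_compat]; lra.
Qed.

Lemma is_lim_accel_G (n : nat) : is_lim_seq (accel_G n) 0.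
Proof.
  pose proof (pos_INR n).
  set (u := (108 * INR n ^ 2 + 174 * INR n + 71) / ((12 * INR n + 5) * (12 * INR n + 11))).
  assert (Hu : 0 <= u) by (apply Rlt_le, Rdiv_lt_0_compat; nra).
  assert (Hv : 0 <= 6 / (12 * INR n + 5)) by (apply Rlt_le, Rdiv_lt_0_compat; lra).
  assert (Hp : 0 <= (1 / 4) ^ n) by (apply pow_le; lra).
  apply is_lim_seq_le_le with (u := fun _ => 0)
    (w := fun k => (1 / 4) ^ n * (u + 6 / (12 * INR n + 5)) * third_ratio k).
  - intros k; unfold accel_G; fold u.
    pose proof (accel_F_bounds n k) as [HF0 HF1]; pose proof (pos_INR k).
    pose proof (third_ratio_pos k).
    replace (6 * INR k / (12 * INR n + 5)) with (6 / (12 * INR n + 5) * INR k)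
      by (field; lra).
    set (v := 6 / (12 * INR n + 5)) in *.
    assert (0 <= v * INR k) by (apply Rmult_le_pos; lra).
    split; [apply Rmult_le_pos; lra|].
    (* The linear factor [u + v k] is at most [(u + v) (k + 1)], and this [k + 1] cancels the
       denominator of [omega_term], leaving the decay of [third_ratio]. *)
    apply Rle_trans with ((1 / 4) ^ n * omega_term k * ((u + v) * (INR k + 1))).
    { apply Rmult_le_compat; try lra; nra. }
    unfold omega_term; right; field; lra.
  - apply is_lim_seq_const.
  - replace (Finite 0)
      with (Rbar_mult ((1 / 4) ^ n * (u + 6 / (12 * INR n + 5))) 0)
      by (simpl; f_equal; ring).
    apply is_lim_seq_scal_l, is_lim_third_ratio.
Qed.

Lemma is_series_accel : is_series (fun n => accel_G n O) (Series omega_term).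
Proof.
  rewrite (Series_ext omega_term (accel_F O)).
  - apply (wz_series accel_F accel_G omega_term (fun n => (1 / 4) ^ n)).
    + exact accel_wz.
    + exact is_lim_accel_G.
    + intros n k; pose proof (accel_F_bounds n k); rewrite Rabs_pos_eq; lra.
    + exact ex_series_omega.
    + apply is_lim_seq_geom; rewrite Rabs_pos_eq; lra.
  - intros k; unfold accel_F, accel_coef, accel_base, omega_term, third_ratio.
    simpl INR; rewrite !Rplus_0_r, pochhammer_1_2; simpl.
    pose proof (pos_INR k); pose proof (pochhammer_pos 1 k).
    pose proof (pochhammer_pos (7 / 6) k).
    field; repeat split; lra.
Qed.

Theorem mainTheorem18 :
  is_series
    (fun k : nat =>
       (1 / 4) ^ k
       * ((pochhammer (5 / 6) k * pochhammer (5 / 3) k)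
          / (pochhammer (17 / 12) k * pochhammer (23 / 12) k))
       * ((108 * INR k ^ 2 + 174 * INR k + 71)
          / ((INR k + 1) * (6 * INR k + 1))))
    (165 * PI / (4 * sqrt 3)).
Proof.
  replace (165 * PI / (4 * sqrt 3)) with (55 * Series omega_term).
  2:{ rewrite Series_omega; unfold Rdiv; ring. }
  (* The 55 undoes the normalisation in [accel_coef], and [(12n+5) (12n+11)] cancels between
     [accel_coef] and [accel_G] at [k = 0]. *)
  apply (is_series_ext (fun n => 55 * accel_G n O)).
  - intros n; fold (accel_base n); match goal with |- ?a = ?b => change (a = b :> R) end.
    unfold accel_G, accel_F, accel_coef; simpl INR; cbn [pochhammer].
    pose proof (pos_INR n); field; repeat split; lra.
  - apply (is_series_scal_l (K := R_AbsRing) 55 _ (Series omega_term)), is_series_accel.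
Qed.
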